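(* Let $m\ge 3$ be an integer and let $\alpha=\alpha(m)$ be the unique real root in $(0,1)$ of the equation \[ (1-x)^{m-2}=\frac{3x}{2-x}. \] Then every simple digraph $D$ on $n$ vertices in which every vertex has outdegree at least $\alpha n$ contains a directed cycle of length at most $m$. Equivalently, $ch(m)\le \alpha(m)$.
   Context: A simple digraph is a directed graph with no loops, no directed cycles of length $2$ (i.e. no pair of opposite edges $(u,v),(v,u)$), and no multiple edges. For an integer $m\ge 3$, $ch(m)$ denotes the smallest positive constant $c$ such that every simple digraph on $n\ge 3$ vertices all of whose outdegrees are at least $c\cdot n$ contains a directed cycle of length at most $m$. *)

(* Defs.v *)
From HB Require Import structures.
From mathcomp Require Import all_boot all_order all_algebra.
From mathcomp Require Import boolp classical_sets reals.
From mathcomp Require Import zify.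

Set Implicit Arguments.
Unset Strict Implicit.
Unset Printing Implicit Defensive.

Import Order.TTheory GRing.Theory Num.Theory.
Local Open Scope ring_scope.

(* The arcs of a digraph on the vertex set T are given by e : rel T, so that
   multiple arcs are excluded by construction. *)
Definition simple_digraph (T : finType) (e : rel T) : Prop :=
  irreflexive e /\ forall u v : T, ~~ (e u v && e v u).

Definition outdeg (T : finType) (e : rel T) (u : T) : nat :=
  #|[set v | e u v]|.

(* The empty sequence satisfies ucycle, hence the lower bound on the size. *)
Definition has_dicycle_le (T : finType) (e : rel T) (m : nat) : Prop :=
  exists c : seq T, ucycle e c /\ (0 < size c <= m)%N.

Definition outdeg_ge (R : realType) (T : finType) (e : rel T) (c : R) : Prop :=
  forall u : T, c * #|T|%:R <= (outdeg e u)%:R.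

Definition forces_dicycle (R : realType) (m : nat) (c : R) : Prop :=
  forall (T : finType) (e : rel T), (3 <= #|T|)%N -> simple_digraph e ->
    outdeg_ge e c -> has_dicycle_le e m.

(* The infimum is a minimum: see ch_min. *)
Definition ch (R : realType) (m : nat) : R :=
  inf [set c : R | 0 < c /\ forces_dicycle m c]%classic.

Definition is_alpha (R : realType) (m : nat) (x : R) : Prop :=
  0 < x < 1 /\ (1 - x) ^+ (m - 2) = 3 * x / (2 - x).

(* The infimum ch R m is attained: if every outdegree of D is at least c n,
   then every outdegree of the lexicographic product D[D] is at least
   c n^2 + c n, and a short directed cycle of D[D] yields one of D. *)
Lemma closed_walk_dicycle (T : finType) (e : rel T) (m : nat) x (p : seq T) :
  path e x p -> last x p = x -> (0 < size p <= m)%N -> has_dicycle_le e m.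
Proof.
case: p => // y p /= /andP[exy yp] lpx /= szp.
case/shortenP: yp lpx => q yq uq sqp lqx.
exists (y :: q); split.
  by rewrite /ucycle uq andbT /= rcons_path yq lqx.
by rewrite /= (leq_ltn_trans _ szp) // uniq_leq_size //; case/andP: uq.
Qed.

Definition lex_rel (T : finType) (e : rel T) : rel (T * T)%type :=
  fun u v => e u.1 v.1 || (u.1 == v.1) && e u.2 v.2.

Lemma lex_rel_path (T : finType) (e : rel T) x p : path (lex_rel e) x p ->
  (x.1 = (last x p).1 /\ path e x.2 (map snd p)) \/
  exists q, [/\ path e x.1 q, last x.1 q = (last x p).1 &
                (0 < size q <= size p)%N].
Proof.
elim: p x => [|y p IH] x /=; first by left.
move=> /andP[/orP[exy|/andP[/eqP xy exy]] /IH[[y1 yp]|[q [yq lq sq]]]].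
- by right; exists [:: y.1]; split; rewrite //= exy.
- by right; exists (y.1 :: q); split; rewrite //= ?exy //; lia.
- by left; rewrite xy exy.
- by right; exists q; split; rewrite ?xy //; lia.
Qed.

Lemma lex_rel_dicycle (T : finType) (e : rel T) m :
  has_dicycle_le (lex_rel e) m -> has_dicycle_le e m.
Proof.
case=> -[|x p] [] // /andP[/= xp _] /= szp.
have lx : last x (rcons p x) = x by rewrite last_rcons.
case: (lex_rel_path xp) => [[_ xq]|[q [xq lq sq]]].
  by apply: (closed_walk_dicycle xq); rewrite ?last_map ?lx ?size_map ?size_rcons.
apply: (closed_walk_dicycle xq); first by rewrite lq lx.
by move: sq; rewrite size_rcons; lia.
Qed.

Lemma lex_rel_simple (T : finType) (e : rel T) :
  simple_digraph e -> simple_digraph (lex_rel e).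
Proof.
move=> [ei ea]; split=> [u|u v]; first by rewrite /lex_rel !ei andbF.
rewrite /lex_rel; have := ea u.1 v.1; have := ea u.2 v.2.
have [->|_] := eqVneq u.1 v.1; first by rewrite !ei ?eqxx.
by rewrite /= !orbF.
Qed.

Lemma outdeg_lex_rel (T : finType) (e : rel T) u : irreflexive e ->
  outdeg (lex_rel e) u = (outdeg e u.1 * #|T| + outdeg e u.2)%N.
Proof.
move=> ei; rewrite /outdeg.
have -> : [set v | lex_rel e u v] =
    finset.setX [set v | e u.1 v] [set: T]%SET :|:
    finset.setX [set u.1] [set v | e u.2 v].
  by apply/finset.setP=> -[v w]; rewrite !inE /lex_rel /= andbT (eq_sym v).
rewrite cardsU !cardsX cardsT cards1 mul1n.
rewrite (_ : _ :&: _ = finset.set0) ?cards0 ?subn0 //.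
apply/finset.setP=> -[v w]; rewrite !inE /= andbT.
by have [->|] := eqVneq v u.1; rewrite ?ei ?andbF.
Qed.

Lemma ordS_path n (x : 'I_n.+1) p : path (fun i j => j == ordS i) x p ->
  last x p = ((x + size p) %% n.+1)%N :> nat.
Proof.
elim: p x => [|y p IH] x /=; first by rewrite addn0 modn_small.
move=> /andP[/eqP -> /IH ->] /=.
by rewrite modnDml addSnnS.
Qed.

Lemma ordS_no_dicycle m : ~ has_dicycle_le (fun i j : 'I_m.+1 => j == ordS i) m.
Proof.
case=> -[|x p] [] // /andP[/= /ordS_path + _] /= szp.
rewrite last_rcons size_rcons => /esym/eqP.
rewrite -[X in _ == X](modn_small (ltn_ord x)) -[X in _ == (X %% _)%N]addn0.
by rewrite eqn_modDl mod0n modn_small //.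
Qed.

Lemma forces_dicycle_ge (R : realType) m (c : R) : (3 <= m)%N ->
  0 < c -> forces_dicycle m c -> m.+1%:R^-1 <= c.
Proof.
move=> m3 c0 fc; rewrite leNgt; apply/negP => cm.
apply: (@ordS_no_dicycle m); apply: fc; first by rewrite card_ord; lia.
  split=> [u|u v]; apply/negP.
    move=> uu; apply: (@ordS_no_dicycle m); exists [:: u].
    by rewrite /ucycle /= uu; split=> //; lia.
  move=> /andP[uv vu].
  apply: (@ordS_no_dicycle m); apply: (@closed_walk_dicycle _ _ _ u [:: v; u]).
  - by rewrite /= uv vu.
  - by [].
  - by rewrite /=; lia.
move=> u; rewrite card_ord /outdeg (_ : [set v | _] = [set ordS u]) ?cards1.
  by rewrite -ler_pdivlMr ?ltr0n // mul1r ltW.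
by apply/finset.setP=> v; rewrite !inE.
Qed.

Lemma forces_dicycle1 (R : realType) m : forces_dicycle m (1 : R).
Proof.
move=> T e T3 [ei _] ge1.
have /card_gt0P[u _] : (0 < #|T|)%N by lia.
have := ge1 u; rewrite mul1r ler_nat leqNgt => /negP[].
rewrite /outdeg -cardsT; apply: proper_card; apply/properP; split.
  exact: finset.subsetT.
by exists u; rewrite !inE // ei.
Qed.

Lemma ch_min (R : realType) (m : nat) : (3 <= m)%N ->
  [/\ 0 < ch R m, forces_dicycle m (ch R m) &
      forall c : R, 0 < c -> forces_dicycle m c -> ch R m <= c].
Proof.
move=> m3; set S := [set c : R | 0 < c /\ forces_dicycle m c]%classic.
have Sinf : has_inf S.
  split; first by exists 1; split=> //; exact: forces_dicycle1.
  by exists 0 => c [/ltW].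
have ch0 : 0 < ch R m.
  apply: (@lt_le_trans _ _ m.+1%:R^-1); first by rewrite invr_gt0 ltr0n.
  apply: lb_le_inf; first by case: Sinf.
  by move=> c [c0 fc]; exact: forces_dicycle_ge.
split=> //; last by move=> c c0 fc; apply: ge_inf; [case: Sinf|].
move=> T e T3 se ge_e; apply: lex_rel_dicycle.
have T0 : 0 < #|T|%:R :> R by rewrite ltr0n; lia.
have eps0 : 0 < ch R m / #|T|%:R by rewrite divr_gt0.
have [c [c0 fc] clt] := inf_adherent eps0 Sinf.
apply: fc; first by rewrite card_prod; nia.
  exact: lex_rel_simple.
move=> u; rewrite outdeg_lex_rel; last by case: se.
rewrite card_prod natrD !natrM.
apply: le_trans (lerD (ler_wpM2r (ltW T0) (ge_e u.1)) (ge_e u.2)).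
rewrite -mulrA -mulrDr.
apply: le_trans (ler_wpM2r _ (ltW clt)) _; first by rewrite mulr_ge0 ?ltW.
by rewrite -/(ch R m) mulrDl mulrDr lerD2l mulrA divfK // gt_eqF.
Qed.

(* Main.v *)
(* Shen's counting argument, by induction on the number n of vertices. Delete
   arcs so that all outdegrees equal r >= a n, and suppose that there is no
   directed cycle of length at most m. By induction every nonempty proper vertex
   set A has a vertex w with fewer than a|A| out-neighbours in A. Hence
   replacing A by A together with N+(w) multiplies n - |A| by at most 1 - a.
   For an arc (u,v) with t common out-neighbours, applying this to these t
   vertices and then m - 3 more times to the resulting set gives a set B within
   distance m - 1 of both u and v, with
     n - |B| <= (1-a)^(m-3) (n - r - (1-a) t).
   B misses the in-neighbours of u and v, so the right-hand side bounds
   |N-(u) U N-(v)|. Sum over all arcs: both t and |N-(u) n N-(v)| sum to the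
   number of transitive triangles, which is less than n r^2 / 2, and |N-(v)| sums
   to at least r^2 n by Cauchy-Schwarz. The outcome contradicts
   (1-a)^(m-2) (2-a) = 3a. *)
Require Import Defs.
From HB Require Import structures.
From mathcomp Require Import all_boot all_order all_algebra.
From mathcomp Require Import boolp classical_sets reals.
From mathcomp Require Import zify ring lra.

Set Implicit Arguments.
Unset Strict Implicit.
Unset Printing Implicit Defensive.

Import Order.TTheory GRing.Theory Num.Theory.
Local Open Scope ring_scope.

(** * Short walks and the directed cycles they close *)

Definition outset (T : finType) (e : rel T) (u : T) : {set T} := [set v | e u v]%SET.

Definition inset (T : finType) (e : rel T) (u : T) : {set T} := [set v | e v u]%SET.

(** Walks of length zero are excluded, so that [walk_le e k x x] always yields a directed cycle. *)
Definition walk_le (T : finType) (e : rel T) (k : nat) (x y : T) : Prop :=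
  exists p, [/\ path e x p, last x p = y & (0 < size p <= k)%N].

Definition hereditarily_sparse (R : realFieldType) (T : finType) (e : rel T)
    (a : R) : Prop :=
  forall A : {set T}, (0 < #|A| < #|T|)%N ->
    exists2 w, w \in A & #|A :&: outset e w|%:R < a * #|A|%:R.

Lemma walk_le1 (T : finType) (e : rel T) x y : e x y -> walk_le e 1 x y.
Proof. by move=> exy; exists [:: y]; rewrite /= exy. Qed.

Lemma walk_leS (T : finType) (e : rel T) k x y z :
  walk_le e k x y -> e y z -> walk_le e k.+1 x z.
Proof.
move=> [p [xp lp sp]] eyz; exists (rcons p z).
by rewrite rcons_path xp lp last_rcons size_rcons eyz; split=> //; lia.
Qed.

Lemma walk_le_weaken (T : finType) (e : rel T) k l x y :
  (k <= l)%N -> walk_le e k x y -> walk_le e l x y.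
Proof. by move=> kl [p [xp lp sp]]; exists p; split=> //; lia. Qed.

Lemma walk_le_dicycle (T : finType) (e : rel T) m x :
  walk_le e m x x -> has_dicycle_le e m.
Proof. by case=> p [xp lp sp]; exact: closed_walk_dicycle xp lp sp. Qed.

Lemma has_dicycle_le_hom (T T' : finType) (e : rel T) (e' : rel T') m
    (f : T -> T') :
  {homo f : x y / e x y >-> e' x y} ->
  has_dicycle_le e m -> has_dicycle_le e' m.
Proof.
move=> fe [[|x p] [] // /andP[/= xp _] szp].
apply: (@closed_walk_dicycle _ _ _ (f x) (map f (rcons p x))).
- by apply: (homo_path (f := f)) xp.
- by rewrite last_map last_rcons.
- by rewrite size_map size_rcons.
Qed.

(** A loop or a pair of opposite arcs is already a directed cycle of length at most 2. The numeric
    form can be summed over pairs of vertices. *)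
Lemma acyclic_arcs (T : finType) (e : rel T) m : (2 <= m)%N ->
  ~ has_dicycle_le e m -> forall u v, (e u v + e v u <= (u != v))%N.
Proof.
move=> m2 noC u v.
have [<-|_] := eqVneq u v.
  case euu: (e u u) => //=; case: noC; apply: (@walk_le_dicycle _ _ _ u).
  by apply: walk_le_weaken (walk_le1 euu); lia.
case euv: (e u v); case evu: (e v u) => //.
case: noC; apply: (@walk_le_dicycle _ _ _ u).
exact: walk_le_weaken m2 (walk_leS (walk_le1 euv) evu).
Qed.

(** * Growing sets reachable from both ends of an arc *)

(** With [t = #|A|] and [w] sparse in [A], the set N+(w) meets N+(v) in at most [a * t + (r - t)]
    vertices, so adding N+(w) to N+(v) gains at least [(1 - a) * t]. Everything in N+(w) is two
    steps from both [u] and [v], because [w] is an out-neighbour of both. *)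
Lemma sparse_seed (R : realFieldType) (T : finType) (e : rel T) (a : R) r u v :
  irreflexive e -> (forall x, #|outset e x| = r) ->
  hereditarily_sparse e a -> e u v ->
  exists2 B : {set T},
    forall y, y \in B -> walk_le e 2 u y /\ walk_le e 2 v y &
    r%:R + (1 - a) * #|outset e u :&: outset e v|%:R <= #|B|%:R.
Proof.
move=> ei er sp euv; set A := outset e u :&: outset e v.
have outv y : e v y -> walk_le e 2 u y /\ walk_le e 2 v y.
  move=> evy; split; first exact: walk_leS (walk_le1 euv) evy.
  exact: walk_le_weaken (walk_le1 evy).
have [A0|A0] := posnP #|A|.
  exists (outset e v); first by move=> y; rewrite inE; exact: outv.
  by rewrite A0 mulr0 addr0 er.
have AT : (#|A| < #|T|)%N.
  rewrite -cardsT; apply: proper_card; apply/properP; split.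
    exact: finset.subsetT.
  by exists u; rewrite !inE // ei.
have [|w] := sp A; first by rewrite A0 AT.
rewrite !inE => /andP[euw evw] spw.
exists (outset e v :|: outset e w).
  move=> y; rewrite !inE => /orP[|ewy]; first exact: outv.
  by split; [exact: walk_leS (walk_le1 euw) ewy|exact: walk_leS (walk_le1 evw) ewy].
have c1 := cardsUI (outset e v) (outset e w).
have c2 := cardsID (outset e u) (outset e v).
have c3 : (#|outset e v :&: outset e w| <=
           #|A :&: outset e w| + #|outset e v :\: outset e u|)%N.
  apply: leq_trans (leq_card_setU _ _); apply/subset_leq_card/fintype.subsetP => y.
  by rewrite !inE => /andP[-> ->]; case: (e u y).
rewrite !er in c1 c2; rewrite (finset.setIC (outset e v)) -/A in c2.
move: c1 c2 c3; rewrite -!(ler_nat R) => c1 c2.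
have := congr1 (fun k => k%:R : R) c1; have := congr1 (fun k => k%:R : R) c2.
by rewrite !natrD; lra.
Qed.

(** Of the [r >= a * #|T|] out-neighbours of [w], fewer than [a * #|A|] lie in [A], so more than
    [a * (#|T| - #|A|)] are new. *)
Lemma sparse_grow (R : realFieldType) (T : finType) (e : rel T) (a : R) r
    (A : {set T}) :
  (forall x, #|outset e x| = r) -> a * #|T|%:R <= r%:R ->
  hereditarily_sparse e a -> (0 < #|A| < #|T|)%N ->
  exists2 w, w \in A &
    #|T|%:R - #|A :|: outset e w|%:R <= (1 - a) * (#|T|%:R - #|A|%:R) :> R.
Proof.
move=> er ar sp /sp[w wA spw]; exists w => //.
have := congr1 (fun k => k%:R : R) (cardsUI A (outset e w)).
by rewrite er !natrD; lra.
Qed.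

Lemma sparse_reach (R : realFieldType) (T : finType) (e : rel T) (a : R) r m j
    u v :
  0 < a < 1 -> (0 < r)%N ->
  (forall x, #|outset e x| = r) -> a * #|T|%:R <= r%:R ->
  ~ has_dicycle_le e m -> irreflexive e ->
  hereditarily_sparse e a -> e u v -> (j.+2 < m)%N ->
  exists2 B : {set T},
    forall y, y \in B -> walk_le e j.+2 u y /\ walk_le e j.+2 v y &
    #|T|%:R - #|B|%:R <=
    (1 - a) ^+ j *
      (#|T|%:R - r%:R - (1 - a) * #|outset e u :&: outset e v|%:R).
Proof.
move=> /andP[a0 a1] r0 er ar noC ei sp euv.
(* The induction also carries that [B] is nonempty, as sparsity says nothing about the empty set. *)
suff H : (j.+2 < m)%N -> exists2 B : {set T},
    (0 < #|B|)%N /\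
    forall y, y \in B -> walk_le e j.+2 u y /\ walk_le e j.+2 v y &
    #|T|%:R - #|B|%:R <=
    (1 - a) ^+ j *
      (#|T|%:R - r%:R - (1 - a) * #|outset e u :&: outset e v|%:R).
  by move=> /H[B [_ Bw] Bc]; exists B.
elim: j => [|j IH] jm.
  have [B Bw Bc] := sparse_seed ei er sp euv; exists B; last by rewrite mul1r; lra.
  split=> //; rewrite -(ltr_nat R); apply: lt_le_trans Bc.
  by rewrite ltr_wpDr ?ltr0n // mulr_ge0 ?ler0n //; lra.
have [|B [B0 Bw] Bc] := IH; first by lia.
(* [B] misses [u]: otherwise a closed walk of length at most [j.+2 < m] would pass through [u]. *)
have BT : (#|B| < #|T|)%N.
  rewrite -cardsT; apply: proper_card; apply/properP; split.
    exact: finset.subsetT.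
  exists u; rewrite ?inE //; apply/negP => /Bw[uu _]; apply: noC.
  by apply: (@walk_le_dicycle _ _ _ u); apply: walk_le_weaken uu; lia.
have [|w wB gr] := sparse_grow er ar sp (A := B); first by rewrite B0 BT.
exists (B :|: outset e w).
  split; first by apply: leq_trans B0 _; apply/subset_leq_card/finset.subsetUl.
  move=> y; rewrite !inE => /orP[/Bw[]|ewy].
    by split; [apply: walk_le_weaken a2|apply: walk_le_weaken b].
  by have [uw vw] := Bw _ wB; split; [apply: walk_leS uw ewy|apply: walk_leS vw ewy].
apply: (le_trans gr); rewrite exprS -mulrA ler_wpM2l //; lra.
Qed.

(** With [j = m - 3], an arc from [B] back to [u] or [v] would close a walk of length at most [m].
    The left-hand side is the size of the union of the in-neighbourhoods, expanded so that each term
    can be summed over arcs. *)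
Lemma inset_bound (R : realFieldType) (T : finType) (e : rel T) (a : R) r m
    u v :
  0 < a < 1 -> (0 < r)%N -> (3 <= m)%N ->
  (forall x, #|outset e x| = r) -> a * #|T|%:R <= r%:R ->
  ~ has_dicycle_le e m -> irreflexive e ->
  hereditarily_sparse e a -> e u v ->
  #|inset e u|%:R + #|inset e v|%:R - #|inset e u :&: inset e v|%:R <=
  (1 - a) ^+ (m - 3) *
    (#|T|%:R - r%:R - (1 - a) * #|outset e u :&: outset e v|%:R).
Proof.
move=> a01 r0 m3 er ar noC ei sp euv.
have jm : ((m - 3).+2 < m)%N by lia.
have [B Bw Bc] := sparse_reach a01 r0 er ar noC ei sp euv jm.
apply: le_trans Bc.
have := congr1 (fun k => k%:R : R) (cardsUI (inset e u) (inset e v)).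
have : (#|inset e u :|: inset e v| + #|B| <= #|T|)%N.
  have <- := cardsUI (inset e u :|: inset e v) B.
  rewrite (_ : _ :&: B = finset.set0) ?cards0 ?addn0 ?max_card //.
  apply/finset.setP => y; rewrite !inE; apply/negP => /andP[yi /Bw[uy vy]].
  apply: noC; case/orP: yi => [eyu|eyv].
    by apply: (@walk_le_dicycle _ _ _ u); apply: walk_le_weaken (walk_leS uy eyu); lia.
  by apply: (@walk_le_dicycle _ _ _ v); apply: walk_le_weaken (walk_leS vy eyv); lia.
by rewrite -(ler_nat R) !natrD; lra.
Qed.

(** * Double counting of transitive triangles and in-degrees *)

Definition transitive_triangles (T : finType) (e : rel T) : nat :=
  (\sum_u \sum_v \sum_w e u v * e u w * e v w)%N.

Lemma card_outset (T : finType) (e : rel T) u : #|outset e u| = (\sum_v e u v)%N.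
Proof.
by rewrite -sum1_card big_mkcond; apply: eq_bigr => v _; rewrite inE; case: (e u v).
Qed.

Lemma card_inset (T : finType) (e : rel T) u : #|inset e u| = (\sum_v e v u)%N.
Proof.
by rewrite -sum1_card big_mkcond; apply: eq_bigr => v _; rewrite inE; case: (e v u).
Qed.

(** Here each triangle is counted at its arc from source to middle vertex. *)
Lemma sum_common_out (T : finType) (e : rel T) :
  (\sum_u \sum_v e u v * #|outset e u :&: outset e v|)%N =
  transitive_triangles e.
Proof.
apply: eq_bigr => u _; apply: eq_bigr => v _.
rewrite -sum1_card big_mkcond big_distrr; apply: eq_bigr => w _.
by rewrite !inE; case: (e u v); case: (e u w); case: (e v w).
Qed.

(** Here each triangle is counted at its arc from middle vertex to sink; exchanging sums rotates the
    three variables into place. *)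
Lemma sum_common_in (T : finType) (e : rel T) :
  (\sum_u \sum_v e u v * #|inset e u :&: inset e v|)%N =
  transitive_triangles e.
Proof.
rewrite /transitive_triangles exchange_big /= exchange_big /=.
transitivity (\sum_v \sum_w \sum_u e u v * e u w * e v w)%N.
  apply: eq_bigr => v _; apply: eq_bigr => w _.
  rewrite -sum1_card big_mkcond big_distrr; apply: eq_bigr => u _.
  by rewrite !inE; case: (e u v); case: (e u w); case: (e v w).
rewrite [RHS]exchange_big; apply: eq_bigr => v _; exact: exchange_big.
Qed.

(** Fix the source [u]. For each of the [r * r] pairs [(v, w)] in N+(u), at most one of [e v w],
    [e w v], [v == w] holds. The first two have equal sums ([sw]), and the diagonal contributes [r]
    ([dg]). *)
Lemma transitive_triangles_le (T : finType) (e : rel T) r :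
  (forall u v, e u v + e v u <= (u != v))%N ->
  (forall x, #|outset e x| = r) ->
  (2 * transitive_triangles e + #|T| * r <= #|T| * (r * r))%N.
Proof.
move=> ea er; rewrite /transitive_triangles -!sum_nat_const !big_distrr /=.
rewrite -big_split; apply: leq_sum => u _.
have sw : (\sum_v \sum_w e u v * e u w * e v w =
           \sum_v \sum_w e u v * e u w * e w v)%N.
  rewrite exchange_big; apply: eq_bigr => v _; apply: eq_bigr => w _.
  by rewrite (mulnC (e u w)).
have dg : r = (\sum_v \sum_w e u v * e u w * (v == w))%N.
  rewrite -(er u) card_outset; apply: eq_bigr => v _.
  rewrite (bigD1 v) //= eqxx muln1 mulnb andbb big1 ?addn0 // => w.
  by rewrite eq_sym => /negPf ->; rewrite muln0.
rewrite mul2n -addnn {2}sw {1}dg -!big_split /=.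
rewrite -{1}(er u) -(er u) card_outset big_distrl /=; apply: leq_sum => v _.
rewrite -!big_split big_distrr /=; apply: leq_sum => w _.
by rewrite -!mulnDr -[leqRHS]muln1 leq_mul2l; have := ea v w; case: eqVneq; lia.
Qed.

(** The in-degrees have mean [r]; expand the nonnegative sum of their squared deviations from
    [r]. *)
Lemma sum_inset_sqr (R : realFieldType) (T : finType) (e : rel T) r :
  (forall x, #|outset e x| = r) ->
  #|T|%:R * r%:R ^+ 2 <= \sum_u #|inset e u|%:R ^+ 2 :> R.
Proof.
move=> er.
have sumin : \sum_u #|inset e u|%:R = #|T|%:R * r%:R :> R.
  rewrite -natr_sum -natrM; congr _%:R.
  rewrite -sum_nat_const (eq_bigr _ (fun u _ => card_inset e u)) exchange_big.
  by apply: eq_bigr => u _; rewrite -card_outset er.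
have : 0 <= \sum_u (#|inset e u|%:R - r%:R) ^+ 2 :> R.
  by apply: sumr_ge0 => u _; exact: sqr_ge0.
rewrite (eq_bigr (fun u => #|inset e u|%:R ^+ 2 - #|inset e u|%:R * (2 * r%:R)
  + r%:R ^+ 2)); last by move=> u _; ring.
rewrite big_split sumrB /= -mulr_suml sumin sumr_const -mulr_natl; lra.
Qed.

(** * Regular outdegrees: summing over arcs and the final contradiction *)

Lemma regular_dicycle (R : realFieldType) (T : finType) (e : rel T) (a : R) r m :
  0 < a < 1 -> (1 - a) ^+ (m - 2) * (2 - a) = 3 * a ->
  (3 <= m)%N -> (0 < #|T|)%N ->
  (forall x, #|outset e x| = r) -> a * #|T|%:R <= r%:R ->
  hereditarily_sparse e a -> has_dicycle_le e m.
Proof.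
move=> a01 aE m3 T0 er ar sp; apply: contrapT => noC.
have ea := acyclic_arcs (ltnW m3) noC.
have ei : irreflexive e by move=> u; have := ea u u; rewrite eqxx; case: (e u u).
have n0 : 0 < #|T|%:R :> R by rewrite ltr0n.
case/andP: (a01) => a0 a1.
have r0 : 0 < r%:R :> R by apply: lt_le_trans ar; rewrite mulr_gt0.
have r0n : (0 < r)%N by rewrite -(ltr0n R).
pose E u v : R := (e u v)%:R.
pose t u v : R := #|outset e u :&: outset e v|%:R.
pose s u v : R := #|inset e u :&: inset e v|%:R.
pose d u : R := #|inset e u|%:R.
set b := (1 - a) ^+ (m - 3).
have bE : b * (1 - a) * (2 - a) = 3 * a.
  by rewrite /b -exprSr -aE; congr (_ ^+ _ * _); lia.
have b0 : 0 < b by rewrite exprn_gt0 //; lra.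
have b1 : b <= 1 by rewrite exprn_ile1 //; lra.
have Eout u : \sum_v E u v = r%:R by rewrite -natr_sum -card_outset er.
have Ein v : \sum_u E u v = d v by rewrite -natr_sum -card_inset.
have tri := transitive_triangles_le ea er.
set tau := transitive_triangles e in tri.
have tE : \sum_u \sum_v E u v * t u v = tau%:R.
  rewrite /tau -sum_common_out natr_sum; apply: eq_bigr => u _.
  by rewrite natr_sum; apply: eq_bigr => v _; rewrite natrM.
have sE : \sum_u \sum_v E u v * s u v = tau%:R.
  rewrite /tau -sum_common_in natr_sum; apply: eq_bigr => u _.
  by rewrite natr_sum; apply: eq_bigr => v _; rewrite natrM.
have d1 : \sum_u \sum_v E u v * d u = r%:R * (r%:R * #|T|%:R).
  transitivity (\sum_u r%:R * d u).
    by apply: eq_bigr => u _; rewrite -mulr_suml Eout.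
  rewrite -mulr_sumr; congr (_ * _).
  rewrite -(eq_bigr _ (fun v _ => Ein v)) exchange_big /=.
  by rewrite (eq_bigr _ (fun u _ => Eout u)) sumr_const mulr_natr.
have d2 : \sum_u \sum_v E u v * d v = \sum_v d v ^+ 2.
  by rewrite exchange_big; apply: eq_bigr => v _; rewrite -mulr_suml Ein.
have dge := sum_inset_sqr R er; rewrite -d2 in dge.
have c1 (k : R) : \sum_u \sum_v E u v * k = k * (r%:R * #|T|%:R).
  transitivity (\sum_(u : T) r%:R * k).
    by apply: eq_bigr => u _; rewrite -mulr_suml Eout.
  by rewrite sumr_const -mulr_natr; ring.
(* [E] is the arc indicator: this is [inset_bound] summed over arcs, with both sides zero at
   non-arcs. *)
have main : \sum_u \sum_v (E u v * d u + E u v * d v - E u v * s u v) <=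
    \sum_u \sum_v (E u v * (b * (#|T|%:R - r%:R)) - b * (1 - a) * (E u v * t u v)).
  apply: ler_sum => u _; apply: ler_sum => v _.
  rewrite /E; case euv: (e u v); last by rewrite !mul0r mulr0; lra.
  have := inset_bound a01 r0n m3 er ar noC ei sp euv.
  rewrite -/(d u) -/(d v) -/(s u v) -/(t u v) -/b !mul1r; lra.
have splitl : \sum_u \sum_v (E u v * d u + E u v * d v - E u v * s u v) =
    r%:R * (r%:R * #|T|%:R) + \sum_u \sum_v E u v * d v - tau%:R.
  rewrite -d1 -sE -!big_split -sumrB /=.
  by apply: eq_bigr => u _; rewrite -big_split -sumrB.
have splitr : \sum_u \sum_v (E u v * (b * (#|T|%:R - r%:R))
      - b * (1 - a) * (E u v * t u v)) =
    b * (#|T|%:R - r%:R) * (r%:R * #|T|%:R) - b * (1 - a) * tau%:R.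
  rewrite -c1 -tE mulr_sumr -sumrB; apply: eq_bigr => u _.
  by rewrite mulr_sumr -sumrB.
rewrite splitl splitr in main.
move: tri; rewrite -(ler_nat R) natrD !natrM => tri.
clear - main dge tri a0 a1 ar bE b0 b1 n0 r0.
move: (#|T|%:R) (r%:R) (tau%:R) n0 r0 ar main dge tri => n x y n0 r0 ar main dge tri.
(* From here [n], [x], [y] stand for the order, the outdegree and the triangle count; [g] is the net
   coefficient of [y] in [main]. *)
set g := 1 - b * (1 - a).
have g0 : 0 < g by have := mulr_gt0 b0 a0; rewrite /g; lra.
have h1 : 2 * x ^+ 2 * n - b * (n - x) * (x * n) <= y * g.
  by rewrite /g; lra.
(* The diagonal term [n * x] in [tri] makes this strict, which is what contradicts the equality [bE]
   in the end. *)
have h2 : 2 * (y * g) < n * x ^+ 2 * g.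
  have : 0 < n * x * g by rewrite !mulr_gt0.
  by have := ler_wpM2r (ltW g0) tri; lra.
have h3 : (x * n) * (4 * x - 2 * b * (n - x)) < (x * n) * (x * g).
  by move: h1 h2; lra.
move: h3; rewrite ltr_pM2l ?mulr_gt0 // => h3.
have h4 : x * (3 + 2 * b + b * (1 - a)) < 2 * b * n by move: h3; rewrite /g; lra.
have : a * n * (3 + 2 * b + b * (1 - a)) < 2 * b * n.
  have ba0 : 0 <= b * (1 - a) by apply: mulr_ge0; lra.
  by apply: le_lt_trans h4; apply: ler_wpM2r => //; lra.
(* Cancelling [n] leaves [3 * a < b * (1 - a) * (2 - a)], contrary to [bE]. *)
rewrite mulrAC ltr_pM2r //; lra.
Qed.

(** * Reduction to regular outdegrees and induction on the order *)

Lemma exists_regular_subrel (T : finType) (e : rel T) r :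
  (forall x, (r <= #|outset e x|)%N) ->
  exists2 e' : rel T, subrel e' e & forall x, #|outset e' x| = r.
Proof.
move=> er; exists (fun u v => v \in take r (enum (outset e u))).
  by move=> u v /mem_take; rewrite mem_enum inE.
move=> u; rewrite (_ : outset _ u = [set v in take r (enum (outset e u))]%SET).
  rewrite cardsE (card_uniqP _) ?take_uniq ?enum_uniq //.
  by rewrite size_takel // -cardE.
by apply/finset.setP => v; rewrite !inE.
Qed.

Lemma outdeg_dicycle (R : realType) (a : R) m (T : finType) (e : rel T) :
  0 < a < 1 -> (1 - a) ^+ (m - 2) * (2 - a) = 3 * a -> (3 <= m)%N ->
  (0 < #|T|)%N -> outdeg_ge e a -> has_dicycle_le e m.
Proof.
move=> a01 aE m3; have [n] := ubnP #|T|.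
elim: n T e => // n IH T e Tn T0 ge_e; apply: contrapT => noC.
have /card_gt0P[x0 _] := T0.
(* The common outdegree [r] is the minimum outdegree, attained at [u], so [ge_e u] gives
   [r >= a * #|T|]. *)
have [u _ umin] := arg_minnP (fun x => #|outset e x|) (erefl : xpredT x0).
have [e' sub er] := exists_regular_subrel (fun x => umin x isT).
have noC' : ~ has_dicycle_le e' m.
  by move=> /(has_dicycle_le_hom (f := id) sub).
apply: noC'; apply: regular_dicycle a01 aE m3 T0 er (ge_e u) _ => A /andP[A0 AT].
apply: contrapT => nosp; apply: noC.
(* If sparsity fails at [A], the subdigraph of [e'] induced on [A] satisfies the outdegree
   condition; its short cycle is one of [e]. *)
pose eA : rel {x | x \in A} := fun x y => e' (val x) (val y).
have cA : #|{: {x | x \in A}}| = #|A| by rewrite card_sig.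
apply: (@has_dicycle_le_hom _ _ eA _ _ val) => [x y /sub //|].
apply: IH; rewrite ?cA //; first by lia.
move=> x; rewrite cA leNgt; apply/negP => lt; apply: nosp; exists (val x).
  exact: valP.
apply: le_lt_trans lt; rewrite ler_nat /outdeg -(card_imset _ val_inj).
apply/subset_leq_card/fintype.subsetP => y; rewrite !inE => /andP[yA exy].
by apply/imsetP; exists (exist _ y yA); rewrite ?inE.
Qed.

(** * Existence and uniqueness of the root, and the theorem *)

Lemma is_alphaP (R : realType) m (x : R) : is_alpha m x <->
  0 < x < 1 /\ (1 - x) ^+ (m - 2) * (2 - x) = 3 * x.
Proof.
rewrite /is_alpha; split=> -[x01 xE]; split=> //; have x2 : 2 - x != 0.
- by apply/eqP => ?; lra.
- by rewrite xE divfK.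
- by apply/eqP => ?; lra.
- by rewrite -xE mulfK.
Qed.

(** On (0,1) the left side of the cleared equation is nonincreasing, while [3 * x] strictly
    increases. *)
Lemma alpha_unique (R : realType) m (x y : R) :
  is_alpha m x -> is_alpha m y -> x = y.
Proof.
wlog xy : x y / x < y => [H hx hy|].
  by have [/H|/H|] := ltgtP x y; [exact|move=> h; apply/esym/h|].
move=> /is_alphaP[/andP[x0 x1] xE] /is_alphaP[/andP[y0 y1] yE].
have : (1 - y) ^+ (m - 2) * (2 - y) <= (1 - x) ^+ (m - 2) * (2 - x).
  by apply: ler_pM; rewrite ?exprn_ge0 ?lerXn2r ?nnegrE //; lra.
by rewrite xE yE; lra.
Qed.

(** Intermediate value theorem for the polynomial [p], which equals -2 at 0 and 3 at 1; its root is
    thus interior. *)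
Lemma alpha_exists (R : realType) m : (3 <= m)%N -> exists x : R, is_alpha m x.
Proof.
move=> m3.
pose p : {poly R} := 3 *: 'X - (1 - 'X) ^+ (m - 2) * (2%:P - 'X).
have pE x : p.[x] = 3 * x - (1 - x) ^+ (m - 2) * (2 - x).
  by rewrite /p !hornerE.
have p0 : p.[0] < 0 by rewrite pE subr0 expr1n; lra.
have p1 : 0 < p.[1].
  by rewrite pE subrr expr0n (_ : (m - 2 == 0)%N = false) ?mul0r; [lra|lia].
have [||x /andP[x0 x1] /rootP px] := @poly_ivt R p 0 1; first by lra.
  by rewrite !ltW.
exists x; apply/is_alphaP; split; last by move: px; rewrite pE; lra.
rewrite !lt_neqAle x0 x1 !andbT; apply/andP; split; apply/eqP => xe.
  by move: px; rewrite -xe; lra.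
by move: px; rewrite xe; lra.
Qed.

Theorem theorem1 (R : realType) (m : nat) (hm : (3 <= m)%N) :
  (exists! alpha : R, is_alpha m alpha) /\
  forall alpha : R, is_alpha m alpha ->
    (forall (T : finType) (e : rel T), (0 < #|T|)%N -> simple_digraph e ->
       outdeg_ge e alpha -> has_dicycle_le e m) /\
    ch R m <= alpha.
Proof.
split=> [|a /is_alphaP[a01 aE]].
  have [x hx] := alpha_exists R hm.
  by exists x; split=> // y; exact: alpha_unique.
split=> [T e T0 _|]; first exact: outdeg_dicycle.
have [_ _] := ch_min R hm; apply; first by case/andP: a01.
by move=> T e T3 _; apply: outdeg_dicycle => //; lia.
Qed.
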